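(* Let $\aleph$ be a finitely-supported multiplicity function, with associated $d\times d$ Jordan matrix $J(\aleph)$, and let $$G := \left\{ \begin{pmatrix} 1 & 0 & 0 \\ v & e^{tJ(\aleph)} & 0 \\ t & 0 & 1 \end{pmatrix} \;\middle|\; (v,t)\in\mathbb{C}^d\oplus\mathbb{C}\right\}.$$ Then $G$ is a complex simply connected Lie group whose Lie algebra is isomorphic to $\mathfrak{a}(\aleph)$.
   Context: A finitely-supported multiplicity function is a function $\aleph:\mathbb{C}\times\mathbb{N}\to\{0,1,2,\dots\}$ (with $\mathbb{N}=\{1,2,\dots\}$) that is nonzero at only finitely many pairs. Its Jordan matrix $J(\aleph)$ is the block-diagonal matrix containing, for each $(\lambda,n)$, exactly $\aleph(\lambda,n)$ copies of the $n\times n$ Jordan block $\lambda\mathbb{1}+N_n$, where $N_n$ has ones on the superdiagonal and zeros elsewhere; its size is denoted $d\times d$. The complex Lie algebra $\mathfrak{a}(\aleph) := \mathbb{C}^d\rtimes\mathbb{C}e_0$ is the vector space $\mathbb{C}^d\oplus\mathbb{C}$ in which $\mathbb{C}^d$ is Abelian and $\mathrm{ad}_{e_0}$ acts on $\mathbb{C}^d$ as $J(\aleph)$, i.e. $[(v,t),(u,s)] = (tJ(\aleph)u - sJ(\aleph)v,\,0)$. The matrices in the definition of $G$ are of size $(d+2)\times(d+2)$ in block form. *)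

(* Defs.v *)
From HB Require Import structures.
From mathcomp Require Import all_boot all_order all_algebra.
From mathcomp Require Import finmap complex.
From mathcomp Require Import all_classical all_reals all_analysis.
Import Order.TTheory GRing.Theory Num.Theory.
Import numFieldNormedType.Exports.

Set Implicit Arguments.
Unset Strict Implicit.
Unset Printing Implicit Defensive.

Local Open Scope classical_set_scope.
Local Open Scope ring_scope.
Local Open Scope complex_scope.

(* Packing R[i] as a numClosedFieldType lets the normed topology that
   MathComp-Analysis puts on every numFieldType be inferred for it. For
   functions between normed CC R-modules, [differentiable] and ['d] are then
   complex Frechet differentiability and the complex-linear differential; a
   map that is differentiable at every point of an open set is holomorphic
   there. *)
Definition CC (R : realType) : numClosedFieldType := R[i].

(* The values of [chart_to] outside [chart_dom], and of [chart_from] outside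
   [chart_cod], are irrelevant. *)
Record chart (R : realType) (T : topologicalType) (n : nat) := Chart {
  chart_dom : set T;
  chart_to : T -> 'cV[CC R]_n;
  chart_from : 'cV[CC R]_n -> T }.

Definition chart_cod R T n (c : @chart R T n) : set 'cV[CC R]_n :=
  chart_to c @` chart_dom c.

Definition is_chart R T n (c : @chart R T n) : Prop :=
  [/\ open (chart_dom c), open (chart_cod c),
      {in chart_dom c, cancel (chart_to c) (chart_from c)},
      {in chart_dom c, continuous (chart_to c)} &
      {in chart_cod c, continuous (chart_from c)}].

(* When x runs over the overlap of two charts, [chart_to c x] runs over the
   whole (open) domain of the transition map, so that [atlas_compat] says that
   the transition map is holomorphic. *)
Record is_complex_atlas R T n (A : set (@chart R T n)) : Prop := {
  atlas_chart : forall c, A c -> is_chart c;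
  atlas_cover : forall x, exists2 c, A c & chart_dom c x;
  atlas_compat : forall c c' x, A c -> A c' ->
    chart_dom c x -> chart_dom c' x ->
    differentiable (chart_to c' \o chart_from c) (chart_to c x) }.

Record is_complex_manifold R (T : topologicalType) n
    (A : set (@chart R T n)) : Prop := {
  manifold_hausdorff : hausdorff_space T;
  manifold_second_countable : @second_countable T;
  manifold_atlas : is_complex_atlas A }.

Record complexLieGroup (R : realType) (T : topologicalType) := ComplexLieGroup {
  lie_dim : nat;
  lie_atlas : set (chart R T lie_dim);
  lie_mul : T -> T -> T;
  lie_inv : T -> T;
  lie_one : T;
  lie_manifold : is_complex_manifold lie_atlas;
  lie_mulA : associative lie_mul;
  lie_mul1 : left_id lie_one lie_mul;
  lie_mulV : left_inverse lie_one lie_inv lie_mul;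
  lie_mul_continuous : continuous (fun p : T * T => lie_mul p.1 p.2);
  lie_inv_continuous : continuous lie_inv;
  lie_mul_holomorphic : forall c1 c2 c3 x y,
    lie_atlas c1 -> lie_atlas c2 -> lie_atlas c3 ->
    chart_dom c1 x -> chart_dom c2 y -> chart_dom c3 (lie_mul x y) ->
    differentiable
      (fun p : 'cV[CC R]_lie_dim * 'cV[CC R]_lie_dim =>
         chart_to c3 (lie_mul (chart_from c1 p.1) (chart_from c2 p.2)))
      (chart_to c1 x, chart_to c2 y);
  lie_inv_holomorphic : forall c1 c2 x,
    lie_atlas c1 -> lie_atlas c2 ->
    chart_dom c1 x -> chart_dom c2 (lie_inv x) ->
    differentiable (chart_to c2 \o lie_inv \o chart_from c1) (chart_to c1 x) }.

(* The left-invariant vector field with value u at the identity, read in a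
   chart c around the identity: at p it is the image of u under the
   differential at the identity of the left translation by [chart_from c p]. *)
Definition left_invariant_field R T (L : complexLieGroup R T)
    (c : chart R T (lie_dim L)) (u : 'cV[CC R]_(lie_dim L))
    (p : 'cV[CC R]_(lie_dim L)) : 'cV[CC R]_(lie_dim L) :=
  'd (fun q => chart_to c (lie_mul L (chart_from c p) (chart_from c q)))
     (chart_to c (lie_one L)) u.

(* [X, Y] = DY.X - DX.Y in coordinates *)
Definition field_bracket (K : numFieldType) (V : normedModType K)
    (X Y : V -> V) (p : V) : V :=
  'd Y p (X p) - 'd X p (Y p).

(* The Lie algebra of L is the tangent space at the identity (identified with
   C^n by the chart c), with the bracket of left-invariant vector fields. *)
Definition lie_bracket R T (L : complexLieGroup R T)
    (c : chart R T (lie_dim L)) (u v : 'cV[CC R]_(lie_dim L)) :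
    'cV[CC R]_(lie_dim L) :=
  field_bracket (left_invariant_field c u) (left_invariant_field c v)
    (chart_to c (lie_one L)).

(* The Lie algebra of L is isomorphic to the Lie algebra (V, br). Changing the
   chart changes [lie_bracket] by an isomorphism, so "for every chart around
   the identity" and "for some chart around the identity" agree. *)
Definition lie_algebra_isomorphic R T (L : complexLieGroup R T)
    (V : lmodType (CC R)) (br : V -> V -> V) : Prop :=
  forall c : chart R T (lie_dim L), lie_atlas c -> chart_dom c (lie_one L) ->
  exists f : {linear V -> 'cV[CC R]_(lie_dim L)},
    bijective f /\ forall x y, f (br x y) = lie_bracket c (f x) (f y).

(* L is the complex Lie group structure on the set G of matrices for which the
   product is the matrix product and the complex structure is the one induced
   by the ambient space of matrices: the inclusion is a holomorphic immersion.
   The type [set_type G] carries the subspace topology. *)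
Record is_matrix_lie_group R m (G : set 'M[CC R]_m)
    (L : complexLieGroup R (set_type G)) : Prop := {
  matrix_lie_mul : forall x y, set_val (lie_mul L x y) = set_val x *m set_val y;
  matrix_lie_immersion : forall c x, lie_atlas c -> chart_dom c x ->
    differentiable (set_val \o chart_from c : 'cV[CC R]_(lie_dim L) -> 'M[CC R]_m)
      (chart_to c x) /\
    injective ('d (set_val \o chart_from c : 'cV[CC R]_(lie_dim L) -> 'M[CC R]_m)
      (chart_to c x)) }.

Definition is_path (R : realType) (T : topologicalType) (x y : T)
    (g : R -> T) : Prop :=
  [/\ {within `[0, 1], continuous g}, g 0 = x & g 1 = y].

Definition null_homotopic (R : realType) (T : topologicalType) (x : T)
    (g : R -> T) : Prop :=
  exists H : R * R -> T,
    [/\ {within `[0, 1] `*` `[0, 1], continuous H},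
        {in `[0, 1], forall s, H (0, s) = g s},
        {in `[0, 1], forall s, H (1, s) = x} &
        {in `[0, 1], forall t, H (t, 0) = x /\ H (t, 1) = x}].

Definition simply_connected (R : realType) (T : topologicalType) : Prop :=
  [/\ inhabited T,
      forall x y : T, exists g : R -> T, is_path x y g &
      forall (x : T) (g : R -> T), is_path x x g -> null_homotopic x g].

Definition posnat := {n : nat | (0 < n)%N}.

Definition multiplicity_function (R : realType) :=
  {fsfun CC R * posnat -> nat with 0%N}.

Definition jordan_block (R : realType) (n : nat) (lambda : CC R) : 'M[CC R]_n :=
  lambda%:M + \matrix_(i < n, j < n) (j == i.+1 :> nat)%:R.

(* The pair (lambda, n) stands for the n x n block of eigenvalue lambda. *)
Definition block_size R (s : seq (CC R * posnat)) (i : 'I_(size s)) : nat :=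
  val (tnth (in_tuple s) i).2.

Definition jordan_size R (s : seq (CC R * posnat)) : nat :=
  (\sum_(i < size s) block_size i)%N.

Definition jordan_mx R (s : seq (CC R * posnat)) : 'M[CC R]_(jordan_size s) :=
  \mxdiag_(i < size s) jordan_block (block_size i) (tnth (in_tuple s) i).1.

(* s lists the Jordan blocks prescribed by aleph, in some order. The matrix
   J(aleph) is only defined up to the order of its blocks. *)
Definition lists_blocks R (aleph : multiplicity_function R)
    (s : seq (CC R * posnat)) : Prop :=
  forall p, count_mem p s = aleph p.

Definition expmx (R : realType) (n : nat) (A : 'M[CC R]_n) : 'M[CC R]_n :=
  limn (series (fun k : nat => (k`!%:R : CC R)^-1 *: A ^+ k)).

Definition semidirect_bracket R d (J : 'M[CC R]_d)
    (x y : 'cV[CC R]_d * (CC R)^o) : 'cV[CC R]_d * (CC R)^o :=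
  (x.2 *: (J *m y.1) - y.2 *: (J *m x.1), 0).

Definition semidirect_elt R d (J : 'M[CC R]_d) (v : 'cV[CC R]_d) (t : CC R) :
    'M[CC R]_(1 + (d + 1)) :=
  block_mx 1%:M         0
           (col_mx v
                   t%:M) (block_mx (expmx (t *: J)) 0
                                   0                1%:M).

Definition semidirect_group R d (J : 'M[CC R]_d) : set 'M[CC R]_(1 + (d + 1)) :=
  [set M | exists v t, M = semidirect_elt J v t].

(* Main.v *)
Require Import Defs.
From HB Require Import structures.
From mathcomp Require Import all_boot all_order all_algebra.
From mathcomp Require Import finmap complex.
From mathcomp Require Import all_classical all_reals all_analysis.
From mathcomp Require Import ring.
Import Order.TTheory GRing.Theory Num.Theory.
Import numFieldNormedType.Exports.

(** The pair (v, t) is a global coordinate on G: it is the lower left block of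
    the matrix, and it determines the matrix. In this coordinate the product is
    x * y = x + A(x) y, where A(x) is the lower right block of x, which is affine
    in y. Hence left-invariant vector fields are p |-> A(p) u and their brackets
    only involve the derivative of t |-> e^{tJ} at 0; and G is homeomorphic to
    the vector space C^{d+1}, hence contractible. The only analysis needed is
    that t |-> e^{tJ} converges, is a one-parameter group, and is differentiable
    at 0 with derivative J; all three follow by majorising the partial sums by
    those of the real exponential. *)

Set Implicit Arguments.
Unset Strict Implicit.
Unset Printing Implicit Defensive.

Local Open Scope classical_set_scope.
Local Open Scope ring_scope.
Local Open Scope complex_scope.

(** * Limits and differentials of matrix-valued functions *)

Section Matrices.
Context {K : numFieldType}.

(** A neighbourhood of a matrix contains a product of neighbourhoods of its finitely many entries,
    so finitely many conditions are intersected in the filter. *)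
Lemma cvg_mx (T : Type) (F : set_system T) m n (f : T -> 'M[K]_(m, n))
    (M : 'M[K]_(m, n)) : Filter F ->
  (forall i j, f x i j @[x --> F] --> M i j) -> f @ F --> M.
Proof.
move=> FF fM A [P MP PA].
have FP : F (fun x => forall i j, P i j (f x i j)).
  by do 2![apply: filter_forall => ?]; apply: fM; apply: MP.
exact: (filterS (fun x (h : forall i j, P i j (f x i j)) => PA (f x) h) FP).
Qed.

Lemma cvg_coord (T : Type) (F : set_system T) m n (f : T -> 'M[K]_(m, n))
    (M : 'M[K]_(m, n)) i j : Filter F ->
  f @ F --> M -> f x i j @[x --> F] --> M i j.
Proof.
move=> FF fM.
exact: (cvg_comp _ _ fM (@coord_continuous K m n i j M)).
Qed.

Lemma mx_hausdorff m n : hausdorff_space 'M[K]_(m, n).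
Proof. exact: (@norm_hausdorff K 'M[K]_(m, n)). Qed.

Lemma cvg_mulmx (T : Type) (F : set_system T) m n p (f : T -> 'M[K]_(m, n))
    (g : T -> 'M[K]_(n, p)) (M : 'M[K]_(m, n)) (N : 'M[K]_(n, p)) : Filter F ->
  f @ F --> M -> g @ F --> N -> f x *m g x @[x --> F] --> M *m N.
Proof.
move=> FF fM gN; apply: cvg_mx => i k.
under eq_fun do rewrite mxE.
rewrite mxE.
apply: cvg_big => [|l _]; first exact: add_continuous.
by apply: cvgM; exact: cvg_coord.
Qed.

Lemma is_diff_lin (V W : normedModType K) (f : {linear V -> W}) x :
  continuous f -> is_diff x f f.
Proof. by move=> fc; apply: DiffDef; [exact: linear_differentiable|exact: diff_lin]. Qed.

Lemma is_diff_coord m n (M : 'M[K]_(m, n)) i j :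
  is_diff M (fun N : 'M[K]_(m, n) => N i j : K) (fun N => N i j).
Proof.
have lin : linear (fun N : 'M[K]_(m, n) => N i j : K^o) by move=> a A B; rewrite !mxE.
pose lM := GRing.isLinear.Build _ _ _ _ _ lin.
pose l : {linear 'M[K]_(m, n) -> K} := HB.pack (fun N : 'M[K]_(m, n) => N i j) lM.
exact: (@is_diff_lin _ _ l M (@coord_continuous _ _ _ i j)).
Qed.

Lemma differentiable_mx (V : normedModType K) m n (f : V -> 'M[K]_(m, n)) (x : V) :
  (forall i j, differentiable (fun y => f y i j) x) -> differentiable f x.
Proof.
move=> df.
have -> : f = \sum_(i < m) \sum_(j < n) (fun y => f y i j *: delta_mx i j).
  apply/funext => y; rewrite fct_sumE [LHS]matrix_sum_delta.
  by apply: eq_bigr => i _; rewrite fct_sumE.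
do 2![apply: differentiable_sum => ?].
exact: differentiableZl.
Qed.

(** Each coordinate is linear and continuous, hence its own differential; composing with it
    identifies the differential of [f] entry by entry. *)
Lemma is_diff_mx (V : normedModType K) m n (f df : V -> 'M[K]_(m, n)) (x : V) :
  (forall i j, is_diff x (fun y => f y i j) (fun u => df u i j)) -> is_diff x f df.
Proof.
move=> dfij.
have fx : differentiable f x.
  by apply: differentiable_mx => i j; exact: (@ex_diff _ _ _ _ _ _ _ (dfij i j)).
apply: DiffDef => //; apply/funext => u; apply/matrixP => i j.
have dfx : is_diff x f ('d f x) by apply: DiffDef.
have dc := is_diff_coord (f x) i j.
have dcf : is_diff x (fun y => f y i j) (fun v => ('d f x v) i j) by exact: is_diff_comp.
have := @diff_val _ _ _ _ _ _ _ dcf.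
by rewrite (@diff_val _ _ _ _ _ _ _ (dfij i j)) => /(congr1 (@^~ u)).
Qed.

Lemma differentiable_fst (U W : normedModType K) (p : U * W) : differentiable (@fst U W) p.
Proof.
have lin : linear (@fst U W) by [].
pose lM := GRing.isLinear.Build _ _ _ _ _ lin.
pose l : {linear (U * W)%type -> U} := HB.pack (@fst U W) lM.
have lc : continuous l by move=> -[a b]; exact: cvg_fst.
exact: (@linear_differentiable _ _ _ l p lc).
Qed.

Lemma differentiable_snd (U W : normedModType K) (p : U * W) : differentiable (@snd U W) p.
Proof.
have lin : linear (@snd U W) by [].
pose lM := GRing.isLinear.Build _ _ _ _ _ lin.
pose l : {linear (U * W)%type -> W} := HB.pack (@snd U W) lM.
have lc : continuous l by move=> -[a b]; exact: cvg_snd.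
exact: (@linear_differentiable _ _ _ l p lc).
Qed.
Lemma is_diff_mulmx m n p (M : 'M[K]_(m, n)) (x : 'M[K]_(n, p)) :
  is_diff x (mulmx M) (mulmx M).
Proof.
apply: (@is_diff_lin _ _ (mulmx M : {linear 'M[K]_(n, p) -> 'M[K]_(m, p)})).
move=> y; exact: (@cvg_mulmx _ (nbhs y) _ _ _ (fun=> M) id M y _
  (@cvg_cst _ M _ (nbhs y) _) cvg_id).
Qed.

Lemma is_diff_mulmxr m n p (M : 'M[K]_(n, p)) (x : 'M[K]_(m, n)) :
  is_diff x (mulmx ^~ M) (mulmx ^~ M).
Proof.
apply: (@is_diff_lin _ _ (mulmxr M : {linear 'M[K]_(m, n) -> 'M[K]_(m, p)})).
move=> y; exact: (@cvg_mulmx _ (nbhs y) _ _ _ id (fun=> M) y M _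
  cvg_id (@cvg_cst _ M _ (nbhs y) _)).
Qed.

Lemma differentiable_mulmx (V : normedModType K) m n p (f : V -> 'M[K]_(m, n))
    (g : V -> 'M[K]_(n, p)) x :
  differentiable f x -> differentiable g x -> differentiable (fun y => f y *m g y) x.
Proof.
move=> df dg; apply: differentiable_mx => i j.
have -> : (fun y => (f y *m g y) i j) = \sum_(l < n) (fun y => f y i l * g y l j : K).
  by apply/funext => y; rewrite mxE fct_sumE.
apply: differentiable_sum => l; apply: differentiableM.
  exact: (differentiable_comp df (differentiable_coord _ _ _)).
exact: (differentiable_comp dg (differentiable_coord _ _ _)).
Qed.

Lemma differentiable_block_mx (V : normedModType K) m1 m2 n1 n2
    (a : V -> 'M[K]_(m1, n1)) (b : V -> 'M[K]_(m1, n2))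
    (c : V -> 'M[K]_(m2, n1)) (e : V -> 'M[K]_(m2, n2)) x :
  differentiable a x -> differentiable b x -> differentiable c x ->
  differentiable e x ->
  differentiable (fun y => block_mx (a y) (b y) (c y) (e y)) x.
Proof.
move=> da db dc de; apply: differentiable_mx => i j.
case: (split_ordP i) => i' ->; case: (split_ordP j) => j' ->.
- under eq_fun do rewrite block_mxEul.
  exact: (differentiable_comp da (differentiable_coord _ _ _)).
- under eq_fun do rewrite block_mxEur.
  exact: (differentiable_comp db (differentiable_coord _ _ _)).
- under eq_fun do rewrite block_mxEdl.
  exact: (differentiable_comp dc (differentiable_coord _ _ _)).
- under eq_fun do rewrite block_mxEdr.
  exact: (differentiable_comp de (differentiable_coord _ _ _)).
Qed.

Lemma differentiable_dlsubmx m1 m2 n1 n2 (M : 'M[K]_(m1 + m2, n1 + n2)) :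
  differentiable (@dlsubmx K m1 m2 n1 n2) M.
Proof.
apply: differentiable_mx => i j; under eq_fun do rewrite !mxE.
exact: differentiable_coord.
Qed.

End Matrices.

(** * Exponential series *)

Section TriangularSums.

(** Both sides run over the pairs with [p + q < n], by antidiagonals on the left and by rows on the
    right. Raising [n] by one lengthens each row by one term and adds a row of length one. *)
Lemma big_triangle (V : nmodType) (F : nat -> nat -> V) n :
  \sum_(0 <= k < n) \sum_(0 <= i < k.+1) F i (k - i)%N =
  \sum_(0 <= p < n) \sum_(0 <= q < n - p) F p q.
Proof.
elim: n => [|n IH]; first by rewrite !big_geq.
rewrite big_nat_recr //= IH [RHS]big_nat_recr //= subSnn big_nat1.
rewrite [X in _ + X]big_nat_recr //= subnn addrA; congr (_ + _).
rewrite -big_split /=; apply: eq_big_nat => p /andP[_ pn].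
by rewrite subSn ?(ltnW pn) // big_nat_recr.
Qed.

(* Convertible to [exp_coeff x k], which requires a realType, when [K] is one. *)
Definition exp_term (K : numFieldType) (x : K) (k : nat) : K := x ^+ k / k`!%:R.

(** This is the binomial theorem divided by [k!]. *)
Lemma exp_termD (K : numFieldType) (s t : K) k :
  exp_term (s + t) k = \sum_(0 <= i < k.+1) exp_term s i * exp_term t (k - i).
Proof.
rewrite /exp_term addrC exprDn mulr_suml big_mkord; apply: eq_bigr => i _.
have ik : (i <= k)%N by rewrite -ltnS.
have := bin_fact ik => /(congr1 (fun n => n%:R : K)); rewrite !natrM => <-.
have f0 m : (m`!%:R : K) != 0 by rewrite pnatr_eq0 -lt0n fact_gt0.
have b0 : ('C(k, i)%:R : K) != 0 by rewrite pnatr_eq0 -lt0n bin_gt0.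
rewrite -mulr_natr; field.
by rewrite b0 !f0.
Qed.

(** The square [p, q < n] minus the triangle [p + q < n] leaves the pairs with [p + q >= n]. The
    coefficients [c] stay abstract so as to serve both for the powers of [J] and for the real
    majorant. *)
Lemma exp_series_defect (K : numFieldType) (V : lmodType K) (c : nat -> V)
    (s t : K) n :
  \sum_(0 <= p < n) \sum_(0 <= q < n) (exp_term s p * exp_term t q) *: c (p + q)%N
  - \sum_(0 <= k < n) exp_term (s + t) k *: c k =
  \sum_(0 <= p < n) \sum_(n - p <= q < n) (exp_term s p * exp_term t q) *: c (p + q)%N.
Proof.
have -> : \sum_(0 <= k < n) exp_term (s + t) k *: c k =
    \sum_(0 <= p < n) \sum_(0 <= q < n - p) (exp_term s p * exp_term t q) *: c (p + q)%N.
  rewrite -big_triangle; apply: eq_big_nat => k _.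
  rewrite exp_termD scaler_suml; apply: eq_big_nat => i /andP[_ ik].
  by rewrite subnKC.
rewrite -sumrB; apply: eq_big_nat => p _.
by rewrite (big_cat_nat (n := n - p)%N) //= ?leq_subr // addrAC subrr add0r.
Qed.

End TriangularSums.

(** * Absolute convergence of complex series *)

Section Complex.
Context {R : realType}.
Implicit Types (x y : R) (z : CC R).

Lemma normCC_real x : `|x%:C : CC R| = `|x|%:C.
Proof. by rewrite normc_def /= expr0n addr0 sqrtr_sqr. Qed.

(** Being comparable with 0 in [R[i]] forces the imaginary part to vanish, so every norm and every
    epsilon over [CC R] comes from [R]. *)
Lemma CC_ge0P z : 0 <= z -> exists2 x, 0 <= x & z = x%:C.
Proof.
case: z => a b z0; have /= b0 := ger0_Im z0.
by exists a; move: z0; rewrite b0 ?ler0c.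
Qed.

Lemma CC_gt0P z : 0 < z -> exists2 x, 0 < x & z = x%:C.
Proof.
move=> z0; have [x x0 zE] := CC_ge0P (ltW z0); exists x => //.
by move: z0; rewrite zE ltcR.
Qed.

Lemma continuous_realC : continuous (fun x : R => x%:C : CC R).
Proof.
move=> x; apply/cvgrPdist_lt => e /CC_gt0P[d d0 ->]; near=> y.
rewrite -rmorphB normCC_real ltcR.
by near: y; apply: (cvgr_dist_lt (F := nbhs x)).
Unshelve. all: by end_near. Qed.

(** Comparison test: the real and imaginary parts of the terms are dominated by [b], so both real
    series converge absolutely, and their limits recombine. *)
Lemma CC_series_cvg (u : nat -> CC R) (b : nat -> R) :
  (forall k, `|u k| <= (b k)%:C) -> cvgn (series b) -> cvgn (series u).
Proof.
move=> ub cb.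
have ub' k : `|u k : R[i]| <= (b k)%:C := ub k.
(* Here [f] stands for the real or the imaginary part; only additivity and the bound by the norm
   matter. *)
have cvR (f : R[i] -> R) : f 0 = 0 -> {morph f : z w / z + w} ->
    (forall z : R[i], `|f z|%:C <= `|z|) ->
    cvgn ((fun n => f (series u n)) : R^nat).
  move=> f0 fD fle.
  have -> : (fun n => f (series u n)) = series (fun k => f (u k)).
    by apply/funext => n; exact: (big_morph f fD f0).
  apply: normed_cvg; apply: series_le_cvg cb => [k|k|k] //=.
    by rewrite -ler0c; exact: le_trans (normr_ge0 _) (ub' k).
  by rewrite -lecR; exact: le_trans (fle _) (ub' k).
pose re : R^nat := fun n => complex.Re (series u n).
pose im : R^nat := fun n => complex.Im (series u n).
have cRe : cvgn re.
  by apply: (cvR (@complex.Re R)) => [|[? ?] [? ?]|] //; exact: normc_ge_Re.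
have cIm : cvgn im.
  apply: (cvR (@complex.Im R)) => [|[? ?] [? ?]|z] //.
  (* Multiplication by ['i] preserves the norm and turns the imaginary part, up to sign, into a real
     part. *)
  have := normc_ge_Re (z * 'i); rewrite /= ReiNIm normrN normrM.
  by rewrite [X in _ * X]normc_def /= expr0n expr1n add0r sqrtr1 mulr1.
have -> : series u = (fun n => (re n)%:C + 'i * (im n)%:C : CC R).
  by apply/funext => n; exact: complexE.
apply/cvg_ex; exists ((limn re)%:C + 'i * (limn im)%:C : CC R).
apply: cvgD.
  exact: (continuous_cvg _ (@continuous_realC _)).
by apply: cvgM; [exact: cvg_cst|exact: (continuous_cvg _ (@continuous_realC _))].
Qed.

End Complex.

(** * Powers of a matrix and bounds on their entries *)

Lemma scalemx_exp (K : comPzRingType) d (t : K) (J : 'M[K]_d) k :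
  (t *: J) ^+ k = t ^+ k *: J ^+ k.
Proof.
elim: k => [|k IH]; first by rewrite !expr0 scale1r.
rewrite !exprS IH; apply/matrixP => i j; rewrite !mxE mulr_sumr.
by apply: eq_bigr => l _; rewrite !mxE; ring.
Qed.

(** The sum of the norms of all entries dominates every row sum, which is what the induction on [k]
    needs. *)
Lemma norm_expmx_coord (K : numDomainType) d (J : 'M[K]_d) k i j :
  `|(J ^+ k) i j| <= (\sum_a \sum_b `|J a b|) ^+ k.
Proof.
elim: k i j => [|k IH] i j.
  by rewrite !expr0 mxE; case: (_ == _); rewrite ?normr0 ?normr1 ?ler01.
rewrite !exprS mxE; apply: le_trans (ler_norm_sum _ _ _) _.
apply: (@le_trans _ _ (\sum_l `|J i l| * (\sum_a \sum_b `|J a b|) ^+ k)).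
  by apply: ler_sum => l _; rewrite normrM ler_wpM2l.
rewrite -mulr_suml ler_wpM2r //.
  by apply: exprn_ge0; apply: sumr_ge0 => a _; apply: sumr_ge0.
rewrite [leRHS](bigD1 i) //= lerDl; apply: sumr_ge0 => a _; exact: sumr_ge0.
Qed.

(** * Convergence of the matrix exponential and the one-parameter group law *)

Section Exponential.
Context {R : realType} (d : nat) (J : 'M[CC R]_d).

(** The norm on [CC R] takes its values in [CC R]; its real part brings it back to [R], where the
    majorising exponential lives. *)
Definition modulus (z : CC R) : R := complex.Re (`|z| : R[i]).

Lemma modulusE (z : CC R) : `|z| = (modulus z)%:C.
Proof. by have [x _ zE] := CC_ge0P (normr_ge0 z); rewrite /modulus zE. Qed.

Lemma modulus_ge0 (z : CC R) : 0 <= modulus z.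
Proof. by rewrite -ler0c -modulusE; exact: (@normr_ge0 _ _ z). Qed.

Definition exp_sum (t : CC R) (n : nat) : 'M[CC R]_d :=
  \sum_(0 <= k < n) exp_term t k *: J ^+ k.

Let mu := modulus (\sum_a \sum_b `|J a b|).

Let muE : \sum_a \sum_b `|J a b| = mu%:C.
Proof.
by rewrite -modulusE ger0_norm //; apply: sumr_ge0 => a _; apply: sumr_ge0.
Qed.

Lemma exp_term_bound t k i j :
  `|exp_term t k * (J ^+ k) i j| <= (exp_coeff (modulus t * mu) k)%:C.
Proof.
rewrite normrM /exp_coeff /= exprMn mulrAC rmorphM; apply: ler_pM => //.
  rewrite /exp_term normrM normfV normrX modulusE normr_nat.
  by rewrite rmorphM fmorphV rmorphXn rmorph_nat.
by rewrite rmorphXn /= -muE; exact: norm_expmx_coord.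
Qed.

Lemma exp_sum_coord t n i j :
  exp_sum t n i j = \sum_(0 <= k < n) exp_term t k * (J ^+ k) i j.
Proof. by rewrite summxE; apply: eq_bigr => k _; rewrite mxE. Qed.

Lemma cvg_exp_sum t : exp_sum t @ \oo --> expmx (t *: J).
Proof.
have cc i j : cvgn (series (fun k => exp_term t k * (J ^+ k) i j : CC R)).
  by apply: CC_series_cvg (is_cvg_series_exp_coeff _) => k; exact: exp_term_bound.
have : cvg (exp_sum t @ \oo).
  apply/cvg_ex; exists (\matrix_(i, j)
    limn (series (fun k => exp_term t k * (J ^+ k) i j : CC R))).
  apply: cvg_mx => i j; rewrite mxE.
  by under eq_fun do rewrite exp_sum_coord; exact: cc.
(* [expmx] is a [limn], so once convergence is known it suffices to match the partial sums. *)
suff <- : series (fun k => (k`!%:R : CC R)^-1 *: (t *: J) ^+ k) = exp_sum t by [].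
apply/funext => n; apply: eq_bigr => k _.
by rewrite scalemx_exp scalerA mulrC.
Qed.

Lemma expmx0 : expmx ((0 : CC R) *: J) = 1%:M.
Proof.
apply: (cvg_unique (@mx_hausdorff _ _ _) (F := exp_sum 0 @ \oo)).
  exact: cvg_exp_sum.
apply: cvg_near_cst; near=> n.
(* The empty sum is 0, so the partial sums are constantly 1 only from [n = 1] on. *)
have [m ->] : exists m, n = m.+1.
  by exists n.-1; rewrite prednK //; near: n; exists 1%N.
rewrite /exp_sum big_nat_recl //= big1 ?addr0 => [|k _].
  by rewrite /exp_term expr0 fact0 divr1 scale1r.
by rewrite /exp_term expr0n mul0r scale0r.
Unshelve. all: by end_near. Qed.

Lemma CC_cvg0 (u : nat -> CC R) (b : nat -> R) :
  (forall n, `|u n| <= (b n)%:C) -> b @ \oo --> 0 -> u @ \oo --> 0.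
Proof.
move=> ub /cvgr0Pnorm_lt b0; apply/cvgr0Pnorm_lt => e /CC_gt0P[e' e'0 ->].
near=> n; apply: le_lt_trans (ub n) _; rewrite ltcR.
by apply: le_lt_trans (ler_norm _) _; near: n; exact: b0.
Unshelve. all: by end_near. Qed.

Lemma exp_sum_defect s t n :
  exp_sum s n *m exp_sum t n - exp_sum (s + t) n =
  \sum_(0 <= p < n) \sum_(n - p <= q < n) (exp_term s p * exp_term t q) *: J ^+ (p + q).
Proof.
rewrite -exp_series_defect; congr (_ - _).
rewrite /exp_sum mulmx_suml; apply: eq_bigr => p _.
rewrite mulmx_sumr; apply: eq_bigr => q _.
by rewrite -scalemxAl -scalemxAr scalerA exprD.
Qed.

(* Over the reals and with [c = 1], [exp_series_defect] identifies the bound of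
   the defect with [e_n(a) e_n(b) - e_n(a + b)], which tends to 0 by [expRD]. *)
Lemma exp_defect_cvg0 s t i j :
  (exp_sum s n *m exp_sum t n - exp_sum (s + t) n) i j @[n --> \oo] --> 0.
Proof.
set a := modulus s * mu; set b := modulus t * mu.
pose e := fun x : R => series (exp_coeff x).
apply: (@CC_cvg0 _ (fun n => e a n * e b n - e (a + b) n)) => [n|].
  have := @exp_series_defect R R^o (fun=> 1) a b n.
  under [X in _ - X]eq_bigr do rewrite scaler1.
  have -> : \sum_(0 <= p < n) \sum_(0 <= q < n) (exp_term a p * exp_term b q) *: (1 : R^o)
      = e a n * e b n.
    rewrite /e /series /= mulr_suml; apply: eq_bigr => p _.
    by rewrite mulr_sumr; apply: eq_bigr => q _; rewrite scaler1.
  rewrite -[\sum_(0 <= k < n) exp_term (a + b) k]/(e (a + b) n) => ->.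
  rewrite exp_sum_defect summxE rmorph_sum.
  apply: le_trans (ler_norm_sum _ _ _) _; apply: ler_sum => p _.
  rewrite summxE rmorph_sum.
  apply: le_trans (ler_norm_sum _ _ _) _; apply: ler_sum => q _.
  rewrite scaler1 mxE.
  have -> : exp_term a p * exp_term b q =
     (modulus s ^+ p / p`!%:R) * (modulus t ^+ q / q`!%:R) * mu ^+ (p + q).
    by rewrite /exp_term /a /b !exprMn exprD; ring.
  rewrite normrM [in leRHS]rmorphM; apply: ler_pM => //.
    rewrite /exp_term !normrM !normfV !normrX !normr_nat !modulusE.
    by rewrite !rmorphM !fmorphV !rmorphXn !rmorph_nat.
  by rewrite rmorphXn /= -muE; exact: norm_expmx_coord.
have -> : 0 = expR a * expR b - expR (a + b) by rewrite expRD subrr.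
by apply: cvgB; [apply: cvgM|]; exact: is_cvg_series_exp_coeff.
Qed.

(** The defect of the partial sums tends both to the difference of the two sides and to 0; limits
    are unique. *)
Lemma expmxD s t : expmx ((s + t) *: J) = expmx (s *: J) *m expmx (t *: J).
Proof.
apply/esym/subr0_eq.
apply: (cvg_unique (@mx_hausdorff _ _ _)
  (F := (fun n => exp_sum s n *m exp_sum t n - exp_sum (s + t) n) @ \oo)).
  apply: cvgB; last exact: cvg_exp_sum.
  by apply: cvg_mulmx; exact: cvg_exp_sum.
by apply: cvg_mx => i j; rewrite mxE; exact: exp_defect_cvg0.
Qed.

End Exponential.

(** * Complex differentiability of the exponential *)

Section Derivative.
Context {R : realType} (d : nat) (J : 'M[CC R]_d).

Let mu : R := modulus (\sum_a \sum_b `|J a b|).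

Let mu_ge0 : 0 <= mu. Proof. exact: modulus_ge0. Qed.

(** The terms of degree 0 and 1 cancel. Since [|h| <= 1], each later term carries a factor at most
    [|h| ^+ 2], and what remains is part of the exponential series at [mu]. *)
Lemma exp_sum_tail_bound h m i j : `|h| <= 1 ->
  `|exp_sum J h m.+2 i j - (1%:M + h *: J) i j| <= `|h| ^+ 2 * (expR mu)%:C.
Proof.
move=> h1; rewrite exp_sum_coord !big_nat_recl //=.
have -> : exp_term h 0 * (J ^+ 0) i j = (1%:M : 'M[CC R]_d) i j.
  by rewrite /exp_term !expr0 fact0 divr1 mul1r.
have -> : exp_term h 1 * (J ^+ 1) i j = (h *: J) i j.
  by rewrite /exp_term !expr1 factS fact0 divr1 mxE.
have -> : (1%:M + h *: J) i j = (1%:M : 'M[CC R]_d) i j + (h *: J) i j by rewrite mxE.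
rewrite addrA [_ + _ + _ - _]addrAC subrr add0r.
apply: le_trans (ler_norm_sum _ _ _) _.
apply: (@le_trans _ _
  (\sum_(0 <= k < m) ((modulus h ^+ 2 * exp_coeff mu k.+2)%:C : CC R))).
  apply: ler_sum => k _; apply: le_trans (exp_term_bound _ _ _ _ _) _.
  rewrite lecR /exp_coeff /= exprMn mulrA ler_wpM2r ?invr_ge0 //.
  rewrite ler_wpM2r ?exprn_ge0 // -addn2 exprD mulrC ler_piMr ?exprn_ge0 ?modulus_ge0 //.
  rewrite exprn_ile1 ?modulus_ge0 //.
  by move: h1; rewrite modulusE -[1]/(1%:C) lecR.
rewrite -rmorph_sum -mulr_sumr modulusE -rmorphXn -rmorphM lecR.
rewrite ler_wpM2l ?exprn_ge0 ?modulus_ge0 //.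
(* Restoring the two nonnegative initial terms gives a partial sum of a nondecreasing sequence,
   bounded by its limit [expR mu]. *)
apply: (@le_trans _ _ (series (exp_coeff mu) m.+2)).
  by rewrite /series /= !big_nat_recl //= addrA lerDr addr_ge0 ?exp_coeff_ge0.
apply: nondecreasing_cvgn_le; last exact: is_cvg_series_exp_coeff.
apply/nondecreasing_seqP => n; rewrite /series /= big_nat_recr //= lerDl.
exact: exp_coeff_ge0.
Qed.

Lemma expmx_near0_bound h i j : h != 0 -> `|h| <= 1 ->
  `|expmx (h *: J) i j - (1%:M + h *: J) i j| <= `|h| ^+ 2 * (expR mu + 1)%:C.
Proof.
move=> h0 h1.
have e0 : 0 < `|h| ^+ 2 by rewrite exprn_gt0 // normr_gt0.
have : exp_sum J h n i j @[n --> \oo] --> expmx (h *: J) i j.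
  by apply: cvg_coord; exact: cvg_exp_sum.
(* Taking [|h| ^+ 2] itself as the epsilon accounts for the [+ 1] in the constant: one partial sum
   that close to the limit is enough. *)
move=> /cvgrPdist_le /(_ _ e0).
case=> N _ /(_ N.+2 (leqW (leqnSn N))) hN.
rewrite rmorphD mulrDr rmorph1 mulr1 [leRHS]addrC.
apply: le_trans (ler_distD (exp_sum J h N.+2 i j) _ _) _.
by rewrite lerD // exp_sum_tail_bound.
Qed.

Lemma is_derive_expmx0 i j :
  is_derive (0 : CC R) 1 (fun t : CC R => expmx (t *: J) i j : CC R) (J i j).
Proof.
have c : h^-1 *: (((fun t : CC R => expmx (t *: J) i j : CC R) \o shift 0) (h *: 1)
    - expmx ((0 : CC R) *: J) i j) @[h --> (0 : CC R)^'] --> J i j.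
  apply/cvgrPdist_le => e e0.
  have C0 : (0 : CC R) < (expR mu + 1)%:C by rewrite (ltcR 0) addr_gt0 ?expR_gt0.
  near=> h.
  have h0 : h != 0 by near: h; exact: nbhs_dnbhs_neq.
  have h1 : `|h| <= 1 by near: h; exact: dnbhs0_le.
  have he : `|h| <= e / (expR mu + 1)%:C by near: h; apply: dnbhs0_le; rewrite divr_gt0.
  rewrite /= addr0 [h *: 1]mulr1 expmx0.
  (* The error of the difference quotient is the quadratic remainder divided by [h], hence at most
     [|h|] times the constant; this dictates the bound [he]. *)
  have -> : J i j - h^-1 *: (expmx (h *: J) i j - (1%:M : 'M[CC R]_d) i j) =
      - (h^-1 * (expmx (h *: J) i j - (1%:M + h *: J) i j)).
    rewrite [(1%:M + _) i j]mxE [(h *: J) i j]mxE /GRing.scale /=; field.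
    by [].
  rewrite normrN normrM normfV ler_pdivrMl ?normr_gt0 //.
  apply: le_trans (expmx_near0_bound i j h0 h1) _.
  rewrite expr2 -mulrA ler_wpM2l // -ler_pdivlMr //.
by apply: DeriveDef; [apply/cvg_ex; exists (J i j)|apply: cvg_lim].
Unshelve. all: by end_near. Qed.

Lemma is_diff_expmx0 i j :
  is_diff (0 : CC R) (fun t : CC R => expmx (t *: J) i j : CC R) (fun h => h * J i j).
Proof.
have [dE vE] := is_derive_expmx0 i j.
apply: DiffDef; first exact/derivable1_diffP.
by rewrite deriv1E // derive1E vE.
Qed.

(** The group law gives [e^{sJ} = e^{tJ} e^{(s-t)J}], which moves the question to 0. *)
Lemma differentiable_expmx t i j :
  differentiable (fun t : CC R => expmx (t *: J) i j : CC R) t.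
Proof.
have -> : (fun t : CC R => expmx (t *: J) i j : CC R) =
    (fun h => (expmx (t *: J) *m expmx (h *: J)) i j : CC R) \o (fun s => s - t).
  by apply/funext => s /=; rewrite -expmxD addrC subrK.
apply: differentiable_comp; first exact: differentiableB.
rewrite subrr.
have -> : (fun h => (expmx (t *: J) *m expmx (h *: J)) i j : CC R) =
    \sum_(l < d) (fun h => expmx (t *: J) i l * expmx (h *: J) l j : CC R).
  by apply/funext => h; rewrite mxE fct_sumE.
apply: differentiable_sum => l.
apply: differentiableM => //.
exact: (@ex_diff _ _ _ _ _ _ _ (is_diff_expmx0 l j)).
Qed.

End Derivative.

(** * Topology of complex vector spaces *)

Lemma second_countable_retract (S T : topologicalType) (f : S -> T) (g : T -> S) :
  continuous f -> continuous g -> cancel g f ->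
  @second_countable S -> @second_countable T.
Proof.
move=> fc gc gK [B Bc [Bo Bn]]; exists [set g @^-1` U | U in B].
  exact: card_le_trans (card_image_le _ _) Bc.
split=> [_ [U BU <-]|y W yW].
  by apply: open_comp => [z _|]; [exact: gc|exact: Bo].
have fW : nbhs (g y) (f @^-1` W) by apply: fc; rewrite gK.
have [U [BU Ugy] UW] := Bn _ _ fW.
by exists (g @^-1` U) => [|z /UW]; [split=> //; exists U|rewrite /= gK].
Qed.

(** * Second countability of spaces of complex matrices *)

Section ComplexSpace.
Context {R : realType}.

Lemma normCC_le (z : R[i]) : `|z| <= (`|complex.Re z| + `|complex.Im z|)%:C.
Proof.
rewrite [X in `|X|]complexE; apply: le_trans (ler_normD _ _) _.
rewrite normrM rmorphD lerD ?normCC_real //.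
by rewrite [X in X * _]normc_def /= expr0n expr1n add0r sqrtr1 mul1r.
Qed.

Lemma CC_rat_dense (z : R[i]) (e : R) : 0 < e ->
  exists q : rat * rat, `|z - ((ratr q.1 : R) +i* (ratr q.2 : R))| < e%:C.
Proof.
move=> e0; have e2 : 0 < e / 2 by rewrite divr_gt0.
have approx (x : R) : exists q : rat, `|x - ratr q| < e / 2.
  have [|q] := @rat_in_itvoo _ (x - e / 2) (x + e / 2).
    by rewrite ltrD2l gtrN.
  by rewrite in_itv /= => xq; exists q; rewrite ltr_distlC.
have [q1 h1] := approx (complex.Re z); have [q2 h2] := approx (complex.Im z).
exists (q1, q2); apply: le_lt_trans (normCC_le _) _; rewrite ltcR [ltRHS]splitr.
by apply: ltrD; case: z h1 h2.
Qed.

(** The base consists of the balls of radius [1 / (k + 1)] around matrices with Gaussian rational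
    entries; finite families of rationals form a countable type. *)
Lemma second_countable_CC_mx m n : @second_countable 'M[CC R]_(m, n).
Proof.
pose center (q : {ffun 'I_m * 'I_n -> rat * rat}) : 'M[CC R]_(m, n) :=
  \matrix_(i, j) ((ratr (q (i, j)).1 : R) +i* (ratr (q (i, j)).2 : R)).
pose r (k : nat) : CC R := (k.+1%:R^-1 : R)%:C.
have r0 k : 0 < r k by rewrite (ltcR 0) invr_gt0.
exists (range (fun qk : {ffun 'I_m * 'I_n -> rat * rat} * nat =>
    ball (center qk.1) (r qk.2))).
  apply: card_le_trans (card_image_le _ _) _; exact: countableP.
split=> [_ [[q k] _ <-]|x W /nbhs_ballP[e /= /CC_gt0P[e' e'0 ->] eW]].
  exact: ball_open.
(* The radius is below [e' / 2], so a ball of that radius containing [x] stays within distance [e']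
   of [x]. *)
have [|k] := @ltr_add_invr R 0 (e' / 2) _; first by rewrite divr_gt0.
rewrite add0r => ke.
have /choice[q hq] : forall ij : 'I_m * 'I_n, exists q : rat * rat,
    `|x ij.1 ij.2 - ((ratr q.1 : R) +i* (ratr q.2 : R))| < r k.
  by move=> ij; apply: CC_rat_dense; rewrite invr_gt0.
have xq : ball (center (finfun q)) (r k) x.
  apply: ball_sym; split=> // i j; rewrite /center mxE ffunE -ball_normE /=.
  exact: hq (i, j).
exists (ball (center (finfun q)) (r k)).
  by split=> //; exists (finfun q, k).
move=> y yq; apply: eW.
apply: (@le_ball _ _ _ (r k + r k)).
  by rewrite -rmorphD lecR [leRHS]splitr lerD // ltW.
by apply: ball_triangle yq; exact: ball_sym.
Qed.

End ComplexSpace.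

(** * Straight-line homotopies and simple connectedness *)

Section Contractible.
Context {R : realType} (V : normedModType (CC R)).

Definition segment (s : R) (v w : V) : V := (1 - s)%:C *: v + s%:C *: w.

Lemma segment0 v w : segment 0 v w = v.
Proof. by rewrite /segment subr0 scale1r scale0r addr0. Qed.

Lemma segment1 v w : segment 1 v w = w.
Proof. by rewrite /segment subrr scale1r scale0r add0r. Qed.

Lemma segmentxx s v : segment s v v = v.
Proof. by rewrite /segment -scalerDl -rmorphD subrK scale1r. Qed.

Lemma cvg_segment (I : Type) (F : set_system I) (s : I -> R) (v w : I -> V) s0 v0 w0 :
  Filter F -> s @ F --> s0 -> v @ F --> v0 -> w @ F --> w0 ->
  segment (s i) (v i) (w i) @[i --> F] --> segment s0 v0 w0.
Proof.
move=> FF ss vv ww; rewrite /segment; apply: cvgD.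
  apply: cvgZ vv; apply: (continuous_cvg _ (@continuous_realC R _)).
  by apply: cvgB ss; exact: cvg_cst.
by apply: cvgZ ww; exact: (continuous_cvg _ (@continuous_realC R _)).
Qed.

(** Segments in [V] are carried to [T] by [f]: they join any two points, and they shrink a loop read
    through [g] to its base point. *)
Lemma simply_connected_retract (T : topologicalType) (f : V -> T) (g : T -> V) :
  continuous f -> continuous g -> cancel g f -> simply_connected R T.
Proof.
move=> fc gc gK; split; first by constructor; exact: (f 0).
  move=> x y; exists (fun s => f (segment s (g x) (g y))); split.
  - apply: continuous_subspaceT => s.
    apply: (continuous_cvg _ (fc _)).
    by apply: cvg_segment; [exact: cvg_id|exact: cvg_cst|exact: cvg_cst].
  - by rewrite segment0 gK.
  - by rewrite segment1 gK.
move=> x c [/subspace_continuousP cc c0 c1].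
exists (fun p => f (segment p.1 (g (c p.2)) (g x))); split => [|s _|s _|t _] /=.
- apply/subspace_continuousP => -[s t] [/= sI tI].
  apply: (continuous_cvg _ (fc _)).
  apply: cvg_segment; [| |exact: cvg_cst].
    by apply: cvg_within_filter; exact: cvg_fst.
  apply: (continuous_cvg _ (gc _)).
  (* The loop is continuous only within the unit interval, so its neighbourhoods are pulled back
     along the second projection, inside the square. *)
  move=> U /(cc _ tI); rewrite /= /within /= => tU.
  have : nbhs (s, t) (snd @^-1` [set y : R | y \in `[0, 1] -> U (c y)]) by exact: cvg_snd.
  by apply: filterS => -[a b] /= h [_ /h].
- by rewrite segment0 gK.
- by rewrite segment1 gK.
(* Both ends of the loop are [x], so the segments there are constant and the base point stays
   fixed. *)
- by rewrite c0 c1 segmentxx gK.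
Qed.

End Contractible.

(** * The group in coordinates *)

Section Group.
Context {R : realType} (d : nat) (J : 'M[CC R]_d).

Local Notation T := (set_type (semidirect_group J)).
Local Notation V := 'cV[CC R]_(d + 1).

(** A pair [(v, t)] is encoded as a single column; this is its component [t]. *)
Definition time (x : V) : CC R := x (rshift d ord0) ord0.

Definition flow (t : CC R) : 'M[CC R]_(d + 1) :=
  block_mx (expmx (t *: J)) 0 0 1%:M.

(** The derivative of [flow] at 0. *)
Definition flow_generator : 'M[CC R]_(d + 1) := block_mx J 0 0 0.

Lemma flow0 : flow 0 = 1%:M.
Proof. by rewrite /flow expmx0 -scalar_mx_block. Qed.

Lemma flowD s t : flow (s + t) = flow s *m flow t.
Proof.
by rewrite /flow expmxD mulmx_block !mul0mx !mulmx0 !addr0 !add0r mulmx1.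
Qed.

(** The lower block row of [flow] is that of the identity. Hence [time] turns [coord_mul] into
    addition, and associativity reduces to [flowD]. *)
Lemma time_flow t x : time (flow t *m x) = time x.
Proof.
rewrite /time /flow -[in LHS](vsubmxK x) mul_block_col !mul0mx add0r mul1mx col_mxEd.
by rewrite mxE.
Qed.

(** The semidirect law [(v, t)(u, s) = (v + e^{tJ} u, t + s)]. *)
Definition coord_mul (x y : V) : V := x + flow (time x) *m y.

Definition coord_inv (x : V) : V := - (flow (- time x) *m x).

Lemma timeD x y : time (x + y) = time x + time y. Proof. by rewrite /time mxE. Qed.

Lemma timeN x : time (- x) = - time x. Proof. by rewrite /time mxE. Qed.

Lemma time0 : time 0 = 0. Proof. by rewrite /time mxE. Qed.

Lemma time_coord_mul x y : time (coord_mul x y) = time x + time y.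
Proof. by rewrite timeD time_flow. Qed.

Lemma coord_mulA : associative coord_mul.
Proof.
move=> x y z; rewrite [RHS](_ : _ = coord_mul x y + flow (time (coord_mul x y)) *m z) //.
by rewrite time_coord_mul flowD -mulmxA /coord_mul -addrA -mulmxDr.
Qed.

Lemma coord_mul0 : left_id 0 coord_mul.
Proof. by move=> x; rewrite /coord_mul time0 flow0 mul1mx add0r. Qed.

Lemma coord_mulV : left_inverse 0 coord_inv coord_mul.
Proof.
by move=> x; rewrite /coord_mul /coord_inv timeN time_flow addNr.
Qed.

(** The matrix [semidirect_elt] with [v] and [t] kept in one column, so that products are computed
    with two-by-two blocks. *)
Definition elt (x : V) : 'M[CC R]_(1 + (d + 1)) := block_mx 1%:M 0 x (flow (time x)).

Lemma eltE x : elt x = semidirect_elt J (usubmx x) (time x).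
Proof.
rewrite /elt /semidirect_elt; congr block_mx.
rewrite -[LHS]vsubmxK; congr col_mx.
by apply/matrixP => i j; rewrite !ord1 !mxE eqxx mulr1n.
Qed.

Lemma semidirect_eltE v t : semidirect_elt J v t = elt (col_mx v t%:M).
Proof. by rewrite eltE col_mxKu /time col_mxEd mxE eqxx mulr1n. Qed.

Lemma elt_mul x y : elt x *m elt y = elt (coord_mul x y).
Proof.
rewrite /elt mulmx_block !mul1mx !mul0mx !mulmx0 !mulmx1 !addr0 !add0r.
by rewrite time_coord_mul flowD.
Qed.

Lemma elt_in x : elt x \in semidirect_group J.
Proof. by rewrite inE eltE; exists (usubmx x), (time x). Qed.

Definition from_coord (x : V) : T := exist _ (elt x) (elt_in x).

Definition to_coord (g : T) : V := dlsubmx (set_val g).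

Lemma from_coordK : cancel from_coord to_coord.
Proof. by move=> x; rewrite /to_coord block_mxKdl. Qed.

Lemma to_coordK : cancel to_coord from_coord.
Proof.
case=> M MG; apply: val_inj; rewrite /= /to_coord set_valE /=.
have /set_mem[v [t ->]] := MG.
by rewrite semidirect_eltE block_mxKdl.
Qed.

Lemma differentiable_flow t : differentiable flow t.
Proof.
apply: differentiable_block_mx => //.
by apply: differentiable_mx => i j; exact: differentiable_expmx.
Qed.

Lemma is_diff_flow0 : is_diff (0 : CC R) flow (fun h => h *: flow_generator).
Proof.
apply: is_diff_mx => i j; rewrite /flow /flow_generator.
case: (split_ordP i) => i' ->; case: (split_ordP j) => j' ->.
- under eq_fun do rewrite block_mxEul.
  under [X in is_diff_def _ _ X]eq_fun do rewrite mxE block_mxEul.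
  exact: is_diff_expmx0.
- under eq_fun do rewrite block_mxEur mxE.
  under [X in is_diff_def _ _ X]eq_fun do rewrite mxE block_mxEur mxE mulr0.
  exact: is_diff_cst.
- under eq_fun do rewrite block_mxEdl mxE.
  under [X in is_diff_def _ _ X]eq_fun do rewrite mxE block_mxEdl mxE mulr0.
  exact: is_diff_cst.
- under eq_fun do rewrite block_mxEdr mxE.
  under [X in is_diff_def _ _ X]eq_fun do rewrite mxE block_mxEdr mxE mulr0.
  exact: is_diff_cst.
Qed.

Lemma is_diff_time x : is_diff x time time.
Proof. exact: is_diff_coord. Qed.

Lemma differentiable_time x : differentiable time x.
Proof. exact: differentiable_coord. Qed.

Lemma differentiable_elt x : differentiable elt x.
Proof.
apply: differentiable_block_mx => //.
exact: (differentiable_comp (differentiable_time x) (differentiable_flow _)).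
Qed.

Lemma differentiable_coord_mul (p : V * V) :
  differentiable (fun p : V * V => coord_mul p.1 p.2) p.
Proof.
have d1 := differentiable_fst p.
have d2 := differentiable_snd p.
apply: differentiableD => //; apply: differentiable_mulmx => //.
apply: (differentiable_comp (f := fun p : V * V => time p.1) _ (differentiable_flow _)).
exact: (differentiable_comp d1 (differentiable_time _)).
Qed.

Lemma differentiable_coord_inv x : differentiable coord_inv x.
Proof.
apply: differentiableN; apply: differentiable_mulmx => //.
apply: (differentiable_comp (f := fun x : V => - time x) _ (differentiable_flow _)).
by apply: differentiableN; exact: differentiable_time.
Qed.

(** The subspace topology is initial for the inclusion, so only the matrix-valued map [elt] has to
    be continuous. *)
Lemma continuous_from_coord : continuous from_coord.
Proof.
apply: (@continuous_comp_initial _ _ _ (set_val : T -> _)) => x.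
exact: (differentiable_continuous (differentiable_elt x)).
Qed.

Lemma continuous_to_coord : continuous to_coord.
Proof.
move=> g; apply: (@continuous_comp _ _ _ (set_val : T -> _) dlsubmx).
  exact: initial_continuous.
exact: (differentiable_continuous (differentiable_dlsubmx _)).
Qed.

End Group.

(** * The Lie group structure and its Lie algebra *)

Section LieGroup.
Context {R : realType} (d : nat) (J : 'M[CC R]_d).

Local Notation T := (set_type (semidirect_group J)).
Local Notation V := 'cV[CC R]_(d + 1).

Definition global_chart : chart R T (d + 1) :=
  Chart setT (@to_coord R d J) (@from_coord R d J).

Definition group_mul (g h : T) : T := from_coord J (coord_mul J (to_coord g) (to_coord h)).

Definition group_inv (g : T) : T := from_coord J (coord_inv J (to_coord g)).

Lemma group_manifold : is_complex_manifold [set global_chart].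
Proof.
split.
(* Points that cannot be separated in the group have coordinates that cannot be separated either,
   since [to_coord] is continuous; it is also injective. *)
- move=> g h gh; apply: (can_inj (@to_coordK R d J)).
  apply: (@mx_hausdorff (CC R)) => A B.
  move=> /(@continuous_to_coord _ _ J g) gA /(@continuous_to_coord _ _ J h) hB.
  by have [x [xA xB]] := gh _ _ gA hB; exists (to_coord x).
- exact: (second_countable_retract (@continuous_from_coord _ _ J)
    (@continuous_to_coord _ _ J) (@to_coordK _ _ J) (@second_countable_CC_mx _ _ _)).
- split=> [_ -> | x | _ _ x -> -> _ _].
  + have cod : chart_cod global_chart = setT.
      by apply/seteqP; split=> // x _; exists (from_coord J x) => //; exact: from_coordK.
    split; rewrite ?cod /=; try exact: openT.
    * by move=> g _; exact: to_coordK.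
    * by move=> g _; exact: continuous_to_coord.
    * by move=> g _; exact: continuous_from_coord.
  + by exists global_chart.
  (* With a single global chart, the only transition map is the identity. *)
  + rewrite (_ : _ \o _ = id) //.
    by apply/funext => y /=; exact: from_coordK.
Qed.

Lemma to_coord_mul g h :
  to_coord (group_mul g h) = coord_mul J (to_coord g) (to_coord h).
Proof. exact: from_coordK. Qed.

Lemma group_mulA : associative group_mul.
Proof.
move=> g h k.
have e : coord_mul J (to_coord g) (to_coord (group_mul h k)) =
    coord_mul J (to_coord (group_mul g h)) (to_coord k).
  rewrite (to_coord_mul h k) (to_coord_mul g h); exact: coord_mulA.
exact: (congr1 (from_coord J) e).
Qed.

Lemma group_mul1 : left_id (from_coord J 0) group_mul.
Proof. by move=> g; rewrite /group_mul from_coordK coord_mul0 to_coordK. Qed.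

Lemma group_mulV : left_inverse (from_coord J 0) group_inv group_mul.
Proof. by move=> g; rewrite /group_mul /group_inv from_coordK coord_mulV. Qed.

Lemma group_mul_continuous : continuous (fun p : T * T => group_mul p.1 p.2).
Proof.
move=> [g h]; apply: (continuous_cvg _ (@continuous_from_coord _ _ J _)).
have c := differentiable_continuous (differentiable_coord_mul J (to_coord g, to_coord h)).
apply: (cvg_comp (fun p : T * T => (to_coord p.1, to_coord p.2)) _ _ c).
have cg : to_coord p.1 @[p --> (g, h)] --> to_coord g.
  by apply: (continuous_cvg _ (@continuous_to_coord _ _ J _)); exact: cvg_fst.
have ch : to_coord p.2 @[p --> (g, h)] --> to_coord h.
  by apply: (continuous_cvg _ (@continuous_to_coord _ _ J _)); exact: cvg_snd.
exact: cvg_pair cg ch.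
Qed.

Lemma group_inv_continuous : continuous group_inv.
Proof.
move=> g.
have c := differentiable_continuous (differentiable_coord_inv J (to_coord g)).
have cg : to_coord h @[h --> g] --> to_coord g by exact: continuous_to_coord.
exact: (cvg_comp _ _ (cvg_comp _ _ cg c) (@continuous_from_coord _ _ J _)).
Qed.

Lemma group_mul_holomorphic (c1 c2 c3 : chart R T (d + 1)) (x y : T) :
  [set global_chart] c1 -> [set global_chart] c2 -> [set global_chart] c3 ->
  chart_dom c1 x -> chart_dom c2 y -> chart_dom c3 (group_mul x y) ->
  differentiable
    (fun p : V * V => chart_to c3 (group_mul (chart_from c1 p.1) (chart_from c2 p.2)))
    (chart_to c1 x, chart_to c2 y).
Proof.
move=> -> -> -> _ _ _.
rewrite (_ : (fun p => _) = (fun p : V * V => coord_mul J p.1 p.2)).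
  exact: differentiable_coord_mul.
by apply/funext => p; rewrite /= /group_mul !from_coordK.
Qed.

Lemma group_inv_holomorphic (c1 c2 : chart R T (d + 1)) (x : T) :
  [set global_chart] c1 -> [set global_chart] c2 ->
  chart_dom c1 x -> chart_dom c2 (group_inv x) ->
  differentiable (chart_to c2 \o group_inv \o chart_from c1) (chart_to c1 x).
Proof.
move=> -> -> _ _.
rewrite (_ : _ \o _ = coord_inv J); first exact: differentiable_coord_inv.
by apply/funext => p; rewrite /= /group_inv !from_coordK.
Qed.

Definition semidirect_lie_group : complexLieGroup R T :=
  ComplexLieGroup group_manifold group_mulA group_mul1 group_mulV
    group_mul_continuous group_inv_continuous group_mul_holomorphic
    group_inv_holomorphic.

Lemma semidirect_matrix_lie_group : is_matrix_lie_group semidirect_lie_group.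
Proof.
split=> [x y|_ x -> _].
  rewrite -{2}[x]to_coordK -{2}[y]to_coordK /= /group_mul.
  by rewrite !set_valE /= elt_mul.
rewrite (_ : _ \o _ = elt J) //.
have de := differentiable_elt J (to_coord x).
split=> //.
(* [dlsubmx] recovers the coordinate from [elt], so by the chain rule its differential is a left
   inverse of that of [elt]. *)
apply: (@can_inj _ _ _ ('d dlsubmx (elt J (to_coord x)))) => u.
have := diff_comp de (differentiable_dlsubmx _).
rewrite (_ : _ \o _ = id); last first.
  by apply/funext => y; rewrite /= block_mxKdl.
by rewrite diff_val => /(congr1 (@^~ u)).
Qed.

(** Left translation by [p] is affine in coordinates, with linear part [flow J (time p)]. *)
Lemma left_invariant_fieldE (u p : V) :
  @left_invariant_field R T semidirect_lie_group global_chart u p = flow J (time p) *m u.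
Proof.
rewrite /left_invariant_field /=.
rewrite (_ : (fun q => _) = cst p + mulmx (flow J (time p))); last first.
  by apply/funext => q; rewrite /group_mul !from_coordK.
have h := is_diffD (is_diff_cst p _)
  (is_diff_mulmx (flow J (time p)) (to_coord (from_coord J 0))).
by rewrite (@diff_val _ _ _ _ _ _ _ h) /= add0r.
Qed.

(** The fields depend on [p] only through [time p], so the chain rule and the derivative of [flow]
    at 0 give their differentials; at the identity the fields take the values [u] and [v]. *)
Lemma lie_bracketE (u v : V) :
  @lie_bracket R T semidirect_lie_group global_chart u v =
  time u *: (flow_generator J *m v) - time v *: (flow_generator J *m u).
Proof.
have dX (w : V) : is_diff (0 : V) (fun p : V => flow J (time p) *m w)
    (fun p => time p *: (flow_generator J *m w)).
  have h1 := is_diff_time (0 : V).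
  have h2 := is_diff_flow0 J; rewrite -(@time0 R d) in h2.
  have h3 := is_diff_mulmxr w (flow J (time (0 : V))).
  have := is_diff_comp (is_diff_comp h1 h2) h3.
  by move/is_diff_eq; apply; apply/funext => p /=; rewrite scalemxAl.
have e (w : V) : @left_invariant_field R T semidirect_lie_group global_chart w =
    (fun p : V => flow J (time p) *m w).
  by apply/funext => p; exact: left_invariant_fieldE.
rewrite /lie_bracket /field_bracket !e /= from_coordK.
have dE (w p : V) : 'd (fun q : V => flow J (time q) *m w) (0 : V) p =
    time p *: (flow_generator J *m w).
  by rewrite (@diff_val _ _ _ _ _ _ _ (dX w)).
by congr (_ - _); (apply: etrans (dE _ _) _); rewrite time0 flow0 mul1mx.
Qed.

Lemma semidirect_lie_algebra :
  lie_algebra_isomorphic semidirect_lie_group (semidirect_bracket J).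
Proof.
move=> _ -> _.
(* The isomorphism stacks the pair into one column; its inverse splits the column again. *)
pose f (x : 'cV[CC R]_d * (CC R)^o) : V := col_mx x.1 (x.2 : CC R)%:M.
have lin : linear f.
  by move=> a x y; rewrite /f scale_col_mx add_col_mx scale_scalar_mx -raddfD.
pose lM := GRing.isLinear.Build _ _ _ _ _ lin.
pose l : {linear ('cV[CC R]_d * (CC R)^o)%type -> V} := HB.pack f lM.
have time_f x : time (f x) = x.2 by rewrite /time /f col_mxEd mxE eqxx mulr1n.
exists l; split=> [|x y].
  exists (fun x : V => (usubmx x, time x)) => [[v t]|x].
    by rewrite time_f /= col_mxKu.
  rewrite /= /f -[RHS]vsubmxK; congr col_mx.
  by apply/matrixP => i j; rewrite !ord1 !mxE eqxx mulr1n.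
rewrite lie_bracketE /= !time_f /f /flow_generator /=.
rewrite !mul_block_col !mul0mx !addr0 !scale_col_mx !scaler0 opp_col_mx add_col_mx.
(* The upper blocks agree. The lower one vanishes because the last row of [flow_generator] is zero,
   matching the second component 0 of the bracket. *)
congr col_mx; rewrite subrr; apply/matrixP => i j.
by rewrite !mxE mul0rn.
Qed.

End LieGroup.

Theorem proposition3p3 (R : realType) (aleph : multiplicity_function R)
    (s : seq (CC R * posnat)) (hs : lists_blocks aleph s) :
  let J := jordan_mx s in
  let G := semidirect_group J in
  exists L : complexLieGroup R (set_type G),
    [/\ is_matrix_lie_group L,
        simply_connected R (set_type G) &
        lie_algebra_isomorphic L (semidirect_bracket J)].
Proof.
move=> J G; exists (semidirect_lie_group J); split.
- exact: semidirect_matrix_lie_group.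
- exact: (simply_connected_retract (@continuous_from_coord _ _ J)
    (@continuous_to_coord _ _ J) (@to_coordK _ _ J)).
- exact: semidirect_lie_algebra.
Qed.
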